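(* For every $d\ge1$, there are at most $(d!)^{d+1}\,2^{3^d\,d!}$ distinct $\mathrm{GL}_d(\mathbb Z)$-orbits of $d$-dimensional symmetric lattice polytopes $P\subset\mathbb R^d$ whose interior contains no nonzero element of $\mathbb Z^d$.
   Context: A lattice polytope is the convex hull of finitely many points of $\mathbb Z^d$; it is $d$-dimensional if it has nonempty interior; it is symmetric if $P=-P$. $\mathrm{GL}_d(\mathbb Z)$ acts linearly on $\mathbb R^d$ and hence on such polytopes. *)

(* Defs.v *)
From Stdlib Require Import Reals ZArith.
From mathcomp Require Import all_boot.
Set Implicit Arguments. Unset Strict Implicit. Unset Printing Implicit Defensive.

Definition vecR (d : nat) := 'I_d -> R.
Definition vecZ (d : nat) := 'I_d -> Z.

Definition zvec (d : nat) (z : vecZ d) : vecR d := fun i => IZR (z i).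

Definition in_conv (d : nat) (V : seq (vecZ d)) (x : vecR d) : Prop :=
  exists w : nat -> R,
    (forall k, (k < size V)%N -> Rle R0 (w k)) /\
    \big[Rplus/R0]_(k < size V) w k = R1 /\
    forall i : 'I_d,
      x i = \big[Rplus/R0]_(k < size V) Rmult (w k) (IZR (nth (fun _ => 0%Z) V k i)).

Definition lattice_polytope (d : nat) (P : vecR d -> Prop) : Prop :=
  exists V : seq (vecZ d), forall x, P x <-> in_conv V x.

Definition symmetric (d : nat) (P : vecR d -> Prop) : Prop :=
  forall x : vecR d, P x <-> P (fun i => Ropp (x i)).

Definition interior_pt (d : nat) (P : vecR d -> Prop) (x : vecR d) : Prop :=
  exists eps : R, Rlt R0 eps /\
    forall y : vecR d, (forall i, Rlt (Rabs (Rminus (y i) (x i))) eps) -> P y.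

Definition full_dim (d : nat) (P : vecR d -> Prop) : Prop :=
  exists x, interior_pt P x.

Definition no_nonzero_interior_lattice_pt (d : nat) (P : vecR d -> Prop) : Prop :=
  forall z : vecZ d, (exists i, z i <> 0%Z) -> ~ interior_pt P (zvec z).

Definition kron (d : nat) (i j : 'I_d) : Z := if i == j then 1%Z else 0%Z.

Definition GLZ (d : nat) (A : 'I_d -> 'I_d -> Z) : Prop :=
  exists B : 'I_d -> 'I_d -> Z,
    forall i j : 'I_d,
      \big[Z.add/0%Z]_(k < d) Z.mul (A i k) (B k j) = kron i j /\
      \big[Z.add/0%Z]_(k < d) Z.mul (B i k) (A k j) = kron i j.

Definition act (d : nat) (A : 'I_d -> 'I_d -> Z) (x : vecR d) : vecR d :=
  fun i => \big[Rplus/R0]_(j < d) Rmult (IZR (A i j)) (x j).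

Definition GL_equiv (d : nat) (P Q : vecR d -> Prop) : Prop :=
  exists A, GLZ A /\
    forall y : vecR d, Q y <-> exists x, P x /\ forall i, y i = act A x i.

Definition good_polytope (d : nat) (P : vecR d -> Prop) : Prop :=
  lattice_polytope P /\ full_dim P /\ symmetric P /\
  no_nonzero_interior_lattice_pt P.

(* Main.v *)
Require Import Defs.
From Stdlib Require Import Reals ZArith.
From mathcomp Require Import all_boot.
From mathcomp Require Import all_order all_fingroup all_algebra.
From mathcomp Require Import ssrZ zify lra boolp Rstruct.

(** Among the d-tuples of vertices of P, let V be one of maximal nonzero |det|.
By Cramer's rule P lies in V[-1,1]^d, and by Minkowski's theorem applied to the
cross-polytope conv(±v_i) inside P, |det V| <= d!. Left multiplication by GL_d(Z)
brings V to a Hermite normal form H; there are at most m^d such H of determinant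
m, hence at most (d!)^(d+1) in all. Each H[-1,1]^d contains at most 3^d |det H|
lattice points z: the class modulo H Z^d, together with the position of each
coordinate of H^-1 z with respect to 0 and 1, determines z. The orbit of P is
determined by H and by the set of these points that are vertices of the moved P. *)

Set Implicit Arguments. Unset Strict Implicit. Unset Printing Implicit Defensive.
Import Order.TTheory GRing.Theory Num.Theory.
Local Open Scope ring_scope.

(** * Cosets of a sublattice of Z^n *)

Lemma abszM_unit (a b : int) : a \is a GRing.unit -> absz (a * b) = absz b.
Proof. by case/pred2P=> ->; rewrite ?mul1r ?mulN1r ?abszN. Qed.

(** In the Smith form [H = L D R] both [L] and [R] are unimodular, so the class of [z] modulo
    [H Z^n] amounts to the residues of the coordinates of [L^-1 z] modulo the diagonal entries of
    [D]. *)
Lemma coset_code n (H : 'M[int]_n) : \det H != 0 ->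
  exists (C : finType) (f : 'cV[int]_n -> C), #|C| = absz (\det H) /\
    forall z z', f z = f z' -> exists t, z - z' = H *m t.
Proof.
have [L Lu [R Ru [s _ ->]]] := int_Smith_normal_form H.
set D := \matrix_(i, j) _.
have DE : D = diag_mx (\row_i s`_i).
  by apply/matrixP=> i j; rewrite !mxE.
have detD : \det D = \prod_(i < n) s`_i.
  by rewrite DE det_diag; apply: eq_bigr => i _; rewrite mxE.
move=> nz.
have Dnz : \det D != 0.
  by apply: contraNneq nz => D0; rewrite !det_mulmx D0 mulr0 mul0r.
have snz (i : 'I_n) : s`_i != 0.
  by apply: contraNneq Dnz => s0; rewrite detD (bigD1 i) //= s0 mul0r.
(* The [.-1.+1] gives [inord] the successor it expects; it changes nothing because no diagonal entry
   vanishes. *)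
exists {dffun forall i : 'I_n, 'I_((absz s`_i).-1.+1)}.
exists (fun z => [ffun i : 'I_n => inord (absz (modz ((invmx L *m z) i 0) s`_i)) :
   'I_((absz s`_i).-1.+1)]).
have sp (i : 'I_n) : (absz s`_i).-1.+1 = (absz s`_i).
  by rewrite prednK // absz_gt0.
split.
  rewrite card_dep_ffun -[RHS]/(absz _) !det_mulmx mulrC mulrA -mulrA.
  rewrite abszM_unit; last by rewrite -unitmxE.
  rewrite abszM_unit; last by rewrite -unitmxE.
  rewrite detD (big_morph absz abszM (erefl _)).
  rewrite foldrE big_map big_enum /=.
  by apply: eq_bigr => i _; rewrite card_ord sp.
move=> z z' /ffunP fE.
have dv (i : 'I_n) : exists q, (invmx L *m (z - z')) i 0 = s`_i * q.
  have := fE i; rewrite !ffunE => /(congr1 val) /=.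
  rewrite !inordK ?sp; try by rewrite -ltz_nat gez0_abs ?modz_ge0 // ltz_mod.
  move=> /(congr1 Posz); rewrite !gez0_abs ?modz_ge0 // => /eqP.
  rewrite eqz_mod_dvd => /dvdzP[q qE]; exists q.
  by rewrite mulmxBr mulrC -qE !mxE.
have [q qE] := fin_all_exists dv.
exists (invmx R *m \col_i q i).
rewrite -mulmxA (mulmxA R) mulmxV // mul1mx -mulmxA.
rewrite -[LHS]mul1mx -(mulmxV Lu) -mulmxA; congr (_ *m _).
by apply/colP=> i; rewrite qE DE mul_diag_mx !mxE.
Qed.

(** * Minkowski's theorem for cross-polytopes *)

(** Bernoulli's inequality for [(1 - a / (y + a)) ^ k], multiplied by [(y + a) ^ k] to stay in
    [nat]. *)
Lemma leq_expnD_bernoulli (y a k : nat) :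
  ((y + a) ^ k <= y ^ k + k * a * (y + a) ^ k.-1)%N.
Proof.
elim: k => [|[|k] IH]; rewrite ?expn0 ?expn1 //=; first by lia.
rewrite [leqLHS]expnSr; apply: leq_trans (leq_mul IH (leqnn _)) _.
rewrite /= mulnDl -mulnA -expnSr mulnDr -expnSr.
have : (y ^ k.+1 * a <= (y + a) ^ k.+1 * a)%N.
  by rewrite leq_mul2r leq_exp2r // leq_addr orbT.
by lia.
Qed.

Lemma leq_expn_ffact n d : (n.+1 ^ d <= (d + n) ^_ d)%N.
Proof.
rewrite ffact_prod -[d in (_ ^ d)%N]card_ord -prod_nat_const.
by apply: leq_prod => i _; have := ltn_ord i; lia.
Qed.

(* Blichfeldt's argument, with a grid in place of volumes: modulo the sublattice
   [T adj(H) Z^d], of index [(2 x)^d / m], there are fewer classes than the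
   [2^d 'C(d + n, d)] integer points of an l1 ball of radius about [x], so two of
   these points differ by [T adj(H) u], which [H] maps into [T m Z^d]. *)
Lemma minkowski_crosspolytope d (H : 'M[int]_d) : (d`! < absz (\det H))%N ->
  exists (N : nat) (t z : 'cV[int]_d),
    [/\ t != 0, H *m t = N%:Z *: z & (\sum_i absz (t i ord0) < N)%N].
Proof.
set m := absz (\det H) => dm.
have d0 : (0 < d)%N.
  by case: d H @m dm => // H; rewrite det_mx00.
have detH : \det H != 0.
  by apply: contraTneq dm => E; rewrite /m E -leqNgt.
(* [x] makes the Bernoulli error [m d^2 x^(d-1)] exactly [x^d], which the strict inequality [d! < m]
   absorbs; [T] satisfies [T m = 2 x]. *)
pose T := (2 * d ^ 2)%N; pose x := (m * d ^ 2)%N; pose n := (x - d)%N.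
have mgt0 : (0 < m)%N by rewrite /m absz_gt0.
have dx : (d <= x)%N.
  apply: leq_trans (leq_pmull _ mgt0); rewrite expnS expn1; exact: leq_pmulr.
have nd : (d + n = x)%N by rewrite /n subnKC.
pose H2 : 'M[int]_d := T%:Z *: \adj H.
have detH2 : (absz (\det H2) * m = (2 * x) ^ d)%N.
  rewrite /H2 detZ /m -abszM -mulrA -det_mulmx mul_adj_mx det_scalar -exprMn.
  by rewrite abszX abszM absz_nat -/m /T /x; congr (_ ^ _)%N; lia.
have H2nz : \det H2 != 0.
  rewrite -absz_gt0; move: detH2; case: absz => // /esym/eqP.
  by rewrite mul0n expn_eq0; move: dx d0; lia.
have [C [f [cC fP]]] := coset_code H2nz.
(* [e] is a bijection onto the integers that makes the two signs symmetric
   around -1/2, so that no integer is hit twice. *)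
pose e (b : bool) (n : nat) := if b then Posz n else Negz n.
have e_inj b b' k k' : e b k = e b' k' -> b = b' /\ k = k'.
  by case: b; case: b' => //= -[].
have e_dist b b' k k' : (absz (e b k - e b' k')%R <= k + k' + 1)%N.
  by rewrite /e; case: b; case: b'; lia.
pose g (p : d.-tuple 'I_n.+1 * {ffun 'I_d -> bool}) : 'cV[int]_d :=
  \col_i e (p.2 i) (tnth p.1 i).
have g_inj : injective g.
  move=> [p b] [p' b'] /colP E; congr pair.
    apply: eq_from_tnth => i; apply: val_inj.
    by have := E i; rewrite !mxE /= => /e_inj[].
  by apply/ffunP=> i; have := E i; rewrite !mxE /= => /e_inj[].
pose A := setX [set p : d.-tuple 'I_n.+1 | \sum_(i <- p) i <= n]%N
  [set: {ffun 'I_d -> bool}].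
have cA : #|A| = ('C(d + n, d) * 2 ^ d)%N.
  by rewrite cardsX card_partial_ord_partitions cardsT card_ffun card_bool card_ord.
have lt : (#|C| < #|A|)%N.
  rewrite ltnNge; apply/negP => le.
  have : ('C(d + n, d) * 2 ^ d * m <= (2 * x) ^ d)%N.
    by rewrite -detH2 -cC -cA leq_mul2r le orbT.
  rewrite mulnAC expnMn [leqRHS]mulnC leq_mul2r expn_eq0 /= => le2.
  have le3 : (n.+1 ^ d * m <= x ^ d * d`!)%N.
    apply: leq_trans (leq_mul (leq_expn_ffact _ _) (leqnn _)) _.
    by rewrite -bin_ffact mulnAC leq_mul2r le2 orbT.
  (* Bernoulli gives [m x^d <= m n^d + x^d]; with [d! + 1 <= m] and [n^d < (n+1)^d] this contradicts
     [le3]. *)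
  have := leq_mul (leqnn m) (leq_expnD_bernoulli n d d).
  rewrite addnC in nd; rewrite nd mulnn.
  rewrite mulnDr mulnA -[(m * d ^ 2)%N]/x -expnS prednK //.
  have : (n ^ d < n.+1 ^ d)%N by rewrite ltn_exp2r.
  rewrite -(ltn_pmul2l mgt0) => h1 h2.
  have : (d`!.+1 * x ^ d <= m * x ^ d)%N by rewrite leq_mul2r dm orbT.
  by rewrite mulSn; lia.
have /dinjectivePn : ~~ dinjectiveb (f \o g) A.
  by apply/negP => /dinjectiveP/leq_card_in; rewrite leqNgt lt.
move=> [p pA [q]]; rewrite !inE /= => /andP[qp qA] /fP[u uE].
(* [H] maps [T adj(H) u] to [T det(H) u]; the sign of [det H] goes into the vector, leaving the
   factor [T m = 2 x]. *)
exists (2 * x)%N, (g p - g q), (sgz (\det H) *: u); split.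
- by rewrite subr_eq0; apply: contraNneq qp => /g_inj ->.
- rewrite uE /H2 -scalemxAl -scalemxAr mulmxA mul_mx_adj mul_scalar_mx !scalerA.
  congr (_ *: _); rewrite {1}[\det H]intEsg -/m mulrCA mulrC.
  by congr (_ * _); rewrite /T /x; lia.
(* The l1 norm is at most [n + n + d], below [2 x = 2 n + 2 d] since [d > 0]. *)
apply: (@leq_ltn_trans (\sum_i (tnth p.1 i + tnth q.1 i + 1))%N).
  by apply: leq_sum => i _; rewrite !mxE; apply: e_dist.
rewrite !big_split /= sum1_card card_ord.
move: pA qA; rewrite !inE !andbT !big_tuple /=.
by rewrite -nd /=; move: d0; lia.
Qed.

(** * Hermite normal forms *)

Definition box n (a : nat) : seq 'cV[int]_n :=
  [seq \col_i Posz (f i) | f : {ffun 'I_n -> 'I_a}].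

(* Lower triangular, each first column being reduced modulo its pivot [a]; in
   this shape the count [a ^ n * (m %/ a) ^ n = m ^ n] is independent of [a]. *)
Fixpoint hermite_forms n (m : nat) : seq 'M[int]_n :=
  if n is n'.+1 then
    flatten [seq [seq (block_mx (Posz a)%:M 0 r H : 'M_(1 + n'))
                 | r <- box n' a, H <- hermite_forms n' (m %/ a)]
            | a <- divisors m]
  else [:: 1%:M].

(** In size [n + 1], each divisor of [m] accounts for at most [m ^ n] forms, and there are at most
    [m] divisors, all lying in [1..m]. *)
Lemma size_hermite_forms n m : (0 < m)%N -> (size (hermite_forms n m) <= m ^ n)%N.
Proof.
elim: n m => [|n IH] m m0 //=.
rewrite size_flatten /shape -map_comp sumnE big_map.
apply: (@leq_trans (\sum_(a <- divisors m) m ^ n)%N).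
  rewrite big_seq [leqRHS]big_seq; apply: leq_sum => a.
  rewrite -dvdn_divisors // => am.
  rewrite /= size_allpairs size_map -cardE card_ffun !card_ord.
  rewrite -{2}(divnK am) mulnC expnMn leq_mul2r; apply/orP; right.
  apply: IH; rewrite divn_gt0; [exact: dvdn_leq|exact: dvdn_gt0 am].
rewrite big_const_seq iter_addn_0 count_predT expnS mulnC leq_mul2r; apply/orP; right.
rewrite -[leqRHS](size_iota 1); apply: uniq_leq_size (divisors_uniq m) _ => a.
by rewrite -dvdn_divisors // mem_iota => am; rewrite (dvdn_gt0 m0 am) ltnS dvdn_leq.
Qed.

(** Row operations clear the first row to the right of its pivot, induction treats the lower right
    block, and subtracting multiples of the pivot row reduces the first column. *)
Lemma hermite_form_exists n (V : 'M[int]_n) : \det V != 0 ->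
  exists2 U, U \in unitmx & U *m V \in hermite_forms n (absz (\det V)).
Proof.
elim: n V => [|n IH] V nz.
  by exists 1%:M; rewrite ?unitmx1 // inE; apply/eqP/matrixP => -[].
rewrite -[n.+1]/(1 + n)%N in V nz *.
have [L Lu [R Ru [s _ sE]]] := int_Smith_normal_form (rsubmx V).
set D := \matrix_(i, j) _ in sE.
(* Smith's form of the [n + 1] by [n] matrix [rsubmx V] has a zero last row,
   which is moved to the top. *)
pose U1 : 'M[int]_(1 + n) := tperm_mx ord0 ord_max *m invmx L.
have U1u : U1 \in unitmx by rewrite unitmx_mul unitmx_perm unitmx_inv.
have U1V : U1 *m V = block_mx ((U1 *m V) ord0 ord0)%:M 0 (dlsubmx (U1 *m V)) (drsubmx (U1 *m V)).
  rewrite -{1}[U1 *m V]submxK; congr block_mx.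
    by rewrite [LHS]mx11_scalar 2!mxE; congr ((U1 *m V) _ _)%:M; apply: val_inj.
  have -> : ursubmx (U1 *m V) = usubmx (U1 *m rsubmx V).
    by apply/matrixP => i j; rewrite mulmx_rsub 2!mxE [RHS]mxE [RHS]mxE.
  rewrite sE /U1 -2!mulmxA [invmx _ *m _]mulmxA mulVmx // mul1mx -row_permE.
  apply/matrixP => i j; rewrite !mxE ord1 (_ : lshift n ord0 = ord0) ?tpermL; last exact: val_inj.
  by apply: big1 => k _; rewrite !mxE /= gtn_eqF ?mulr0n ?mul0r.
set a := _ ord0 ord0 in U1V; set c := dlsubmx _ in U1V; set W := drsubmx _ in U1V.
have detV : absz (\det V) = (absz a * absz (\det W))%N.
  have := congr1 (absz \o determinant) U1V; rewrite /= det_lblock det_scalar1 abszM => <-.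
  by rewrite det_mulmx abszM_unit // -unitmxE.
have /andP[a0 W0] : (a != 0) && (\det W != 0).
  by rewrite -negb_or -mulf_eq0 -absz_eq0 abszM -detV absz_eq0.
have [U' U'u U'W] := IH W W0.
pose q := \col_i ((U' *m c) i ord0 %/ absz a)%Z.
(* [sgz a] makes the pivot positive; the lower left block turns the first column into
   [U' c - |a| q], the vector of remainders. *)
exists (block_mx (sgz a)%:M 0 (- (sgz a *: q)) U' *m U1).
  rewrite unitmx_mul U1u andbT unitmxE det_lblock det_scalar1 unitrM -unitmxE U'u andbT.
  by move: a0; case: sgzP.
rewrite -mulmxA U1V mulmx_block !mul0mx !mulmx0 !addr0 add0r.
rewrite -scalar_mxM mulNmx -scalemxAl mul_mx_scalar scalerA -abszEsg detV.
apply/flattenP.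
set r := - _ + _.
have a0' : (absz a)%:Z != 0 by rewrite eqz_nat -lt0n absz_gt0.
have rE i : r i ord0 = ((U' *m c) i ord0 %% (absz a)%:Z)%Z.
  by rewrite 4!mxE /modz mulrC addrC abszEsg.
have rbox : r \in box n (absz a).
  have rlt i : (absz (r i ord0) < absz a)%N.
    by rewrite -ltz_nat gez0_abs rE ?modz_ge0 // -[ltRHS]gez0_abs // ltz_mod.
  apply/imageP; exists [ffun i => Ordinal (rlt i)] => //.
  by apply/colP => i; rewrite [RHS]mxE ffunE /= gez0_abs // rE modz_ge0.
exists [seq (block_mx (Posz (absz a))%:M 0 r H : 'M_(1 + n))
       | r <- box n (absz a), H <- hermite_forms n (absz (\det W))].
  apply/mapP; exists (absz a); last by rewrite mulKn ?absz_gt0.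
  by rewrite -dvdn_divisors ?muln_gt0 ?absz_gt0 ?a0 // dvdn_mulr.
exact: (allpairs_f (fun r (H : 'M_n) => block_mx _ 0 r H : 'M_(1 + n))).
Qed.

(** * Lattice points in a parallelepiped *)

Lemma finite_cover_of_code (T : eqType) (C : finType) (A : T -> Prop) (f : T -> C) :
  (forall x y, A x -> A y -> f x = f y -> x = y) ->
  exists s : seq T, (size s <= #|C|)%N /\ forall x, A x -> x \in s.
Proof.
move=> fA.
have hc c : exists o : option T, forall x, A x -> f x = c -> o = Some x.
  have [[x [Ax fx]]|no] := EM (exists x, A x /\ f x = c).
    by exists (Some x) => y Ay fy; congr Some; apply: fA => //; rewrite fx.
  by exists None => x Ax fx; case: no; exists x.
have [g gP] := fin_all_exists hc.
exists (pmap g (enum C)); split.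
  by rewrite size_pmap cardE; apply: count_size.
move=> x Ax; rewrite mem_pmap; apply/mapP; exists (f x); first by rewrite mem_enum.
by rewrite (gP _ x).
Qed.

(** On [[-1, 1]] the pieces are [[-1, 0)], [[0, 1)] and [{1}], so that no piece contains two points
    at distance 1. *)
Definition trichotomy (F : realFieldType) (x : F) : 'I_3 :=
  if x < 0 then 0 else if x < 1 then 1 else 2.

Lemma trichotomy_dist (F : realFieldType) (x y : F) :
  `|x| <= 1 -> `|y| <= 1 -> trichotomy x = trichotomy y -> `|x - y| < 1.
Proof.
rewrite /trichotomy ltr_norml !ler_norml => /andP[? ?] /andP[? ?].
by case: ltP => ?; case: ltP => ? //; case: ltP => ? //; case: ltP => ? // _;
  apply/andP; split; lra.
Qed.

(** Two points in the same class differ by [H t] with [t] integral, and [t] is the difference of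
    their coordinates. If these lie in the same pieces, every [|t_i| < 1], whence [t = 0]. *)
Lemma lattice_points_in_parallelepiped (F : realFieldType) d (H : 'M[int]_d) :
  \det H != 0 ->
  exists s : seq 'cV[int]_d, (size s <= 3 ^ d * absz (\det H))%N /\
    forall (z : 'cV[int]_d) (c : 'cV[F]_d),
      map_mx intr z = map_mx intr H *m c -> (forall i, `|c i ord0| <= 1) -> z \in s.
Proof.
move=> nz; have [C [f [cC fP]]] := coset_code nz.
have Hu : map_mx (intr : int -> F) H \in unitmx.
  by rewrite unitmxE det_map_mx unitfE intr_eq0.
pose coord (z : 'cV[int]_d) : 'cV[F]_d := invmx (map_mx intr H) *m map_mx intr z.
pose g (z : 'cV[int]_d) := ([ffun i => trichotomy (coord z i ord0)] : {ffun 'I_d -> 'I_3}, f z).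
have [x y Ax Ay [/ffunP xy /fP[t tE]]|s [sC sP]] := @finite_cover_of_code _ _
  (fun z => forall i, `|coord z i ord0| <= 1) g.
  apply/eqP; rewrite -subr_eq0 tE (_ : t = 0) ?mulmx0 //.
  apply/colP => i; rewrite mxE.
  have : map_mx (intr : int -> F) t = coord x - coord y.
    by rewrite /coord -mulmxBr -map_mxB tE map_mxM mulKmx.
  move=> /colP/(_ i); rewrite !mxE => ti.
  have := xy i; rewrite !ffunE => /(trichotomy_dist (Ax i) (Ay i)).
  rewrite !mxE in ti *; rewrite -ti -intr_norm ltrz1.
  by move: (t i 0) => u; lia.
exists s; split.
  by rewrite card_prod card_ffun !card_ord cC in sC.
move=> z c zE cE; apply: sP => i.
by rewrite /coord zE mulKmx.
Qed.

(** * Convex hulls *)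

Section Hull.
Variables (F : realFieldType) (d : nat).
Implicit Types (S : seq 'cV[F]_d) (x : 'cV[F]_d).

Definition hull S x := exists w : nat -> F,
  [/\ forall k, (k < size S)%N -> 0 <= w k, \sum_(k < size S) w k = 1
    & x = \sum_(k < size S) w k *: S`_k].

Lemma hull_convex S (I : finType) (a : I -> F) (x : I -> 'cV[F]_d) :
  (forall i, 0 <= a i) -> \sum_i a i = 1 -> (forall i, hull S (x i)) ->
  hull S (\sum_i a i *: x i).
Proof.
move=> a0 a1 /fin_all_exists[w wP].
exists (fun k => \sum_i a i * w i k); split.
- move=> k kS; apply: sumr_ge0 => i _; rewrite mulr_ge0 //.
  by have [w0 _ _] := wP i; apply: w0.
- rewrite exchange_big -[RHS]a1; apply: eq_bigr => i _ /=.
  by rewrite -mulr_sumr; have [_ -> _] := wP i; rewrite mulr1.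
under eq_bigr => i _ do [have [_ _ ->] := wP i; rewrite scaler_sumr].
rewrite exchange_big; apply: eq_bigr => k _ /=.
by rewrite scaler_suml; apply: eq_bigr => i _; rewrite scalerA.
Qed.

Lemma mem_hull S x : x \in S -> hull S x.
Proof.
move=> xS; exists (fun k => (k == index x S)%:R); split=> //.
  rewrite (bigD1 (Ordinal (etrans (index_mem x S) xS))) //= eqxx big1 ?addr0 // => i.
  by rewrite -val_eqE /= => /negPf ->.
rewrite (bigD1 (Ordinal (etrans (index_mem x S) xS))) //= eqxx big1 ?addr0 => [|i].
  by rewrite scale1r nth_index.
by rewrite -val_eqE /= => /negPf ->; rewrite scale0r.
Qed.

Lemma hull_subset S T x : (forall y, y \in S -> hull T y) -> hull S x -> hull T x.
Proof.
move=> ST [w [w0 w1 ->]].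
apply: (@hull_convex T _ (fun k : 'I_(size S) => w k) (fun k => S`_k)) => // k.
- exact: w0.
- by apply: ST; rewrite mem_nth.
Qed.

Lemma hull_mulmx S (A : 'M[F]_d) x : hull S x -> hull [seq A *m y | y <- S] (A *m x).
Proof.
move=> [w [w0 w1 ->]]; rewrite mulmx_sumr.
under eq_bigr => k _ do rewrite -scalemxAr.
apply: (@hull_convex _ _ (fun k : 'I_(size S) => w k) (fun k => A *m S`_k)) => // k.
- exact: w0.
- by apply: mem_hull; rewrite map_f ?mem_nth.
Qed.

(** The origin is the midpoint of [y] and [- y]. The sum is then a convex combination of the points
    [v i] or [- v i] with weights [|c i|], the leftover weight going to the origin. *)
Lemma hull_crosspolytope S (v : 'I_d -> 'cV[F]_d) (c : 'I_d -> F) :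
  (exists x, hull S x) -> (forall x, hull S x -> hull S (- x)) ->
  (forall i, hull S (v i)) -> \sum_i `|c i| <= 1 -> hull S (\sum_i c i *: v i).
Proof.
move=> [y Sy] symS Sv c1.
have S0 : hull S 0.
  have -> : 0 = \sum_(b : bool) (2%:R^-1 : F) *: (if b then y else - y).
    by rewrite big_bool /= scalerN subrr.
  apply: hull_convex => [b||[]]; first by rewrite invr_ge0 ler0n.
  - by rewrite big_bool /= [RHS]splitr mul1r.
  - by [].
  - exact: symS.
pose a (k : 'I_d.+1) := oapp (fun i => `|c i|) (1 - \sum_i `|c i|) (unlift ord0 k).
pose x (k : 'I_d.+1) := oapp (fun i => if 0 <= c i then v i else - v i) 0 (unlift ord0 k).
have -> : \sum_i c i *: v i = \sum_k a k *: x k.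
  rewrite big_ord_recl /a /x unlift_none /= scaler0 add0r; apply: eq_bigr => i _.
  by rewrite liftK /=; case: ger0P => // _; rewrite scalerN scaleNr opprK.
apply: hull_convex => [k||k].
- by rewrite /a; case: unliftP => [i|] _ //=; rewrite subr_ge0.
- rewrite big_ord_recl /a unlift_none /=.
  rewrite [X in _ + X](eq_bigr (fun i => `|c i|)) ?subrK // => i _.
  by rewrite liftK.
- by rewrite /x; case: unliftP => [i|] _ //=; case: ifP => _ //; apply: symS.
Qed.

End Hull.

(** * Columns of maximal determinant *)

Section MaximalDeterminant.
Variables (F : realFieldType) (d : nat) (S : seq 'cV[int]_d).
Local Notation toF := (map_mx (intr : int -> F)).

Definition select_columns (f : {ffun 'I_d -> 'I_(size S)}) : 'M[int]_d :=
  \matrix_(i, j) S`_(f j) i ord0.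

(** Take the points of [S] as the rows of [A]: if [A] has rank [d], some [d] rows are independent;
    otherwise a kernel vector is normal to a hyperplane containing [S]. *)
Lemma hyperplane_or_basis :
  (exists2 u : 'rV[F]_d, u != 0 & forall x, x \in S -> u *m toF x = 0) \/
  (exists f, \det (select_columns f) != 0).
Proof.
pose A : 'M[F]_(size S, d) := \matrix_(k, j) (S`_k j ord0)%:~R.
have [fA|nA] := boolP (row_full A).
  right; exists (fullrankfun fA).
  have := fullrowsub_unit fA; rewrite -unitmx_tr unitmxE.
  set B := (rowsub _ _)^T.
  have -> : B = toF (select_columns (fullrankfun fA)).
    by apply/matrixP => i j; rewrite !mxE.
  by rewrite det_map_mx unitfE intr_eq0.
left; have : kermx A^T != 0.
  by rewrite kermx_eq0 /row_free mxrank_tr; move: nA; rewrite /row_full.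
case/rowV0Pn => u /sub_kermxP uA u0; exists u => // x xS.
apply/matrixP => i j; have := xS; rewrite -index_mem => kS.
have /matrixP/(_ i (Ordinal kS)) := uA.
rewrite !mxE => E; rewrite -[RHS]E; apply: eq_bigr => k _; rewrite !mxE /= nth_index //.
by rewrite [j]ord1.
Qed.

(* Cramer's rule: the coordinates of [x] are quotients of two determinants of
   columns from [S], the denominator being the largest. *)
Lemma maximal_determinant :
  (exists f, \det (select_columns f) != 0) ->
  exists V : 'M[int]_d, [/\ \det V != 0, forall j, col j V \in S &
    forall x, x \in S -> exists2 c : 'cV[F]_d, toF x = toF V *m c &
      forall i, `|c i ord0| <= 1].
Proof.
move=> [f0 f0nz].
pose f := [arg max_(f > f0) absz (\det (select_columns f))].
have fmax g : (absz (\det (select_columns g)) <= absz (\det (select_columns f)))%N.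
  by rewrite /f; case: arg_maxnP => // h _ /(_ g isT).
set V := select_columns f in fmax.
have Vnz : \det V != 0.
  by rewrite -absz_gt0; apply: leq_trans (fmax f0); rewrite absz_gt0.
exists V; split=> // [j|x xS].
  suff -> : col j V = S`_(f j) by rewrite mem_nth.
  by apply/colP => i; rewrite !mxE.
exists ((\det V)%:~R^-1 *: toF (\adj V *m x)) => [|i].
  rewrite -scalemxAr -map_mxM mulmxA mul_mx_adj mul_scalar_mx map_mxZ scalerA.
  by rewrite mulVf ?intr_eq0 // scale1r.
have := xS; rewrite -index_mem => kS.
pose g := [ffun j => if j == i then Ordinal kS else f j].
rewrite !mxE normrM normfV -!intr_norm.
rewrite mulrC ler_pdivrMr ?ltr0z ?normr_gt0 // mul1r ler_int.
suff -> : \sum_j \adj V i j * x j ord0 = \det (select_columns g).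
  by have := fmax g; lia.
rewrite (expand_det_col _ i); apply: eq_bigr => j _.
rewrite !mxE ffunE eqxx /= nth_index // mulrC; congr (_ * _).
rewrite /cofactor; congr (_ * \det _); apply/matrixP => k l.
by rewrite !mxE ffunE eq_sym (negPf (neq_lift _ _)).
Qed.

End MaximalDeterminant.

(** [K] bounds the l1 norm of [V^-1 y] in terms of the sup norm of [y], so a perturbation below
    [(1 - s) / (K + 1)] costs at most the slack [1 - s]. The [+ 1] keeps the denominator
    positive. *)
Lemma crosspolytope_interior (F : realFieldType) d (V : 'M[F]_d) (c : 'cV[F]_d) :
  V \in unitmx -> \sum_i `|c i ord0| < 1 ->
  exists2 e : F, 0 < e & forall y : 'cV[F]_d,
    (forall i, `|y i ord0 - (V *m c) i ord0| < e) ->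
    exists2 c' : 'cV[F]_d, y = V *m c' & \sum_i `|c' i ord0| <= 1.
Proof.
move=> Vu c1; set s := \sum_i _ in c1.
pose K := \sum_i \sum_j `|invmx V i j|.
have K0 : 0 <= K by apply: sumr_ge0 => i _; apply: sumr_ge0.
have K1 : 0 < K + 1 by apply: ltr_wpDl.
exists ((1 - s) / (K + 1)) => [|y yP]; first by rewrite divr_gt0 // subr_gt0.
exists (invmx V *m y); first by rewrite mulKVmx.
have -> : invmx V *m y = c + invmx V *m (y - V *m c) by rewrite mulmxBr mulKmx // addrC subrK.
apply: (@le_trans _ _ (s + K * ((1 - s) / (K + 1)))).
  rewrite mulr_suml /s -big_split /=; apply: ler_sum => i _.
  rewrite mxE (le_trans (ler_normD _ _)) // lerD2l mxE mulr_suml.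
  rewrite (le_trans (ler_norm_sum _ _ _)) //; apply: ler_sum => j _.
  rewrite normrM ler_wpM2l // !mxE.
  by have := ltW (yP j); rewrite mxE.
rewrite mulrA -lerBrDl ler_pdivrMr // mulrC ler_wpM2l ?subr_ge0 ?ltW //.
by rewrite ltrDl.
Qed.

(** * From vectors as functions to column matrices *)

Lemma IZR_int_of_Z (z : Z) : IZR z = (int_of_Z z)%:~R :> R.
Proof.
rewrite -{1}[z]int_of_ZK; case: (int_of_Z z) => n.
  by rewrite /= -INR_IZR_INZ INRE.
by rewrite NegzE mulrNz /= opp_IZR -INR_IZR_INZ INRE addn1.
Qed.

Definition colR d (x : vecR d) : 'cV[R]_d := \col_i x i.
Definition colZ d (z : vecZ d) : 'cV[int]_d := \col_i int_of_Z (z i).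
Local Notation toR := (map_mx (intr : int -> R)).

Lemma in_convP d (V : seq (vecZ d)) (x : vecR d) :
  in_conv V x <-> hull [seq toR (colZ z) | z <- V] (colR x).
Proof.
have nthE k i : (k < size V)%N ->
    ([seq toR (colZ z) | z <- V]`_k : 'cV[R]_d) i ord0 = IZR (nth (fun _ => Z0) V k i).
  by move=> kV; rewrite (nth_map (fun _ => Z0)) // !mxE IZR_int_of_Z.
rewrite /hull size_map; split=> [[w [w0 [w1 wx]]]|[w [w0 w1 wx]]]; exists w.
  split=> // [k /w0/RleP //|].
  apply/colP => i; rewrite mxE wx summxE; apply: eq_bigr => k _.
  by rewrite [RHS]mxE nthE.
split=> [k /w0/RleP //|]; split=> // i.
have /colP/(_ i) := wx; rewrite mxE summxE => ->.
by apply: eq_bigr => k _; rewrite mxE nthE.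
Qed.

Lemma lattice_polytopeP d (P : vecR d -> Prop) : lattice_polytope P ->
  exists W : seq 'cV[int]_d, forall x, P x <-> hull [seq toR w | w <- W] (colR x).
Proof.
move=> [V VP]; exists [seq colZ z | z <- V] => x; rewrite VP in_convP.
by rewrite -map_comp.
Qed.

Definition vecR_of d (x : 'cV[R]_d) : vecR d := fun i => x i ord0.

Lemma vecR_ofK d (x : 'cV[R]_d) : colR (vecR_of x) = x.
Proof. by apply/colP => i; rewrite mxE. Qed.

(** Linear maps commute with convex hulls, and [invmx A] is integral as well. The generators are
    compared as sets, which is all that an orbit code records. *)
Lemma GL_equiv_hull d (P Q : vecR d -> Prop) (W W' : seq 'cV[int]_d) (A : 'M[int]_d) :
  (forall x, P x <-> hull [seq toR w | w <- W] (colR x)) ->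
  (forall x, Q x <-> hull [seq toR w | w <- W'] (colR x)) ->
  A \in unitmx -> W' =i [seq A *m w | w <- W] -> GL_equiv P Q.
Proof.
move=> PW QW Au W'E.
have sumZ (f : 'I_d -> int) : \big[Z.add/Z0]_k Z_of_int (f k) = Z_of_int (\sum_k f k).
  by rewrite (big_morph Z_of_int (id1 := Z0) (op1 := Z.add) (rmorphD _) (rmorph0 _)).
have kronE (i j : 'I_d) : kron i j = Z_of_int ((1%:M : 'M[int]_d) i j).
  by rewrite mxE /kron; case: eqP.
have prodE (B C : 'M[int]_d) (i j : 'I_d) : B *m C = 1%:M ->
    \big[Z.add/Z0]_(k < d) Z.mul (Z_of_int (B i k)) (Z_of_int (C k j)) = kron i j.
  move=> BC; rewrite kronE -BC mxE -sumZ; apply: eq_bigr => k _.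
  by rewrite rmorphM.
have actE x : colR (Defs.act (fun i j => Z_of_int (A i j)) x) = toR A *m colR x.
  apply/colP => i; rewrite !mxE /Defs.act; apply: eq_bigr => j _.
  by rewrite !mxE IZR_int_of_Z Z_of_intK.
have hullA x : hull [seq toR w | w <- W] x -> hull [seq toR w | w <- W'] (toR A *m x).
  move=> /(hull_mulmx (toR A)); apply: hull_subset => y.
  rewrite -map_comp => /mapP[w wW ->]; apply: mem_hull.
  by rewrite /= -map_mxM map_f // W'E map_f.
have hullV x : hull [seq toR w | w <- W'] x ->
    hull [seq toR w | w <- W] (toR (invmx A) *m x).
  move=> /(hull_mulmx (toR (invmx A))); apply: hull_subset => y.
  rewrite -map_comp => /mapP[w]; rewrite W'E => /mapP[v vW ->] ->; apply: mem_hull.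
  by rewrite /= -map_mxM mulKmx // map_f.
exists (fun i j => Z_of_int (A i j)); split.
  exists (fun i j => Z_of_int (invmx A i j)) => i j.
  by split; apply: prodE; rewrite ?mulmxV ?mulVmx.
move=> y; rewrite QW; split=> [/hullV Wy|[x [/PW/hullA Wx yx]]].
  exists (vecR_of (toR (invmx A) *m colR y)); split; first by rewrite PW vecR_ofK.
  move=> i; have /colP/(_ i) := actE (vecR_of (toR (invmx A) *m colR y)).
  by rewrite vecR_ofK mulmxA -map_mxM mulmxV // map_mx1 mul1mx !mxE.
by rewrite (_ : colR y = toR A *m colR x) // -actE; apply/colP => i; rewrite !mxE yx.
Qed.

(** * Determinant bound and normal form of a good polytope *)

(** An interior point can be moved by [e / 2] along each axis without leaving [P], which forces each
    coordinate of [u] to vanish. *)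
Lemma full_dim_not_hyperplane d (P : vecR d -> Prop) (u : 'rV[R]_d) :
  full_dim P -> (forall x, P x -> u *m colR x = 0) -> u = 0.
Proof.
move=> [x [e [/RltP e0' Pe]]] uP; have e0 : 0 < e :> R by exact: e0'.
 apply/rowP => i; rewrite [RHS]mxE.
pose y := vecR_of (colR x + (e / 2) *: delta_mx i ord0).
have Py : P y.
  apply: Pe => j; apply/RltP; rewrite RabsE RminusE /y /vecR_of !mxE eqxx andbT.
  rewrite addrAC subrr add0r.
  by case: (j == i); rewrite ?mulr1n ?mulr0n ?mulr1 ?mulr0 ?normr0 // ger0_norm; lra.
have Px : P x.
  by apply: Pe => j; apply/RltP; rewrite RabsE RminusE subrr normr0.
have := uP _ Py; rewrite /y vecR_ofK mulmxDr uP // add0r -scalemxAr.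
move/matrixP/(_ ord0 ord0); rewrite -colE !mxE => /eqP.
by rewrite mulf_eq0 gt_eqF /= => [/eqP|]; last lra.
Qed.

Definition all_hermite_forms d (M : nat) : seq 'M[int]_d :=
  flatten [seq hermite_forms d m | m <- iota 1 M].

Lemma size_all_hermite_forms d M : (size (all_hermite_forms d M) <= M ^ (d + 1))%N.
Proof.
rewrite size_flatten /shape -map_comp sumnE big_map.
apply: (@leq_trans (\sum_(m <- iota 1 M) M ^ d)%N).
  rewrite big_seq [leqRHS]big_seq; apply: leq_sum => m.
  rewrite mem_iota add1n ltnS => /andP[m0 mM].
  apply: leq_trans (size_hermite_forms d m0) _.
  by case: d => [|d]; rewrite ?expn0 // leq_exp2r.
by rewrite big_const_seq iter_addn_0 count_predT size_iota addn1 expnSr.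
Qed.

(** A larger determinant would yield a nonzero lattice point [z = V (t / N)] with [t / N] of l1 norm
    below 1, hence interior to the cross-polytope on the columns of [V], which symmetry and
    convexity place inside [P]. *)
Lemma good_polytope_det d (P : vecR d -> Prop) (V : 'M[int]_d) :
  good_polytope P -> \det V != 0 -> (forall j, P (vecR_of (toR (col j V)))) ->
  (absz (\det V) <= d`!)%N.
Proof.
move=> [/lattice_polytopeP[W WP] [[x [e [e0 Pe]]] [symP noP]]] Vnz PV.
rewrite leqNgt; apply/negP => /minkowski_crosspolytope[N [t [z [t0 Vt tN]]]].
have N0 : (0 < N)%N by apply: leq_ltn_trans tN.
have NR : 0 < N%:R :> R by rewrite ltr0n.
have Vu : toR V \in unitmx by rewrite unitmxE det_map_mx unitfE intr_eq0.
pose c : 'cV[R]_d := N%:R^-1 *: toR t.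
have zc : toR z = toR V *m c.
  rewrite /c -scalemxAr -map_mxM Vt map_mxZ scalerA.
  by rewrite mulVf ?scale1r // gt_eqF.
have c1 : \sum_i `|c i ord0| < 1.
  under eq_bigr => i _ do rewrite !mxE normrM normfV -intr_norm normr_nat.
  rewrite -mulr_sumr mulrC ltr_pdivrMr // mul1r.
  under eq_bigr => i _ do rewrite -natr_absz.
  by rewrite -natr_sum ltr_nat.
have [r r0 rP] := crosspolytope_interior Vu c1.
apply: (noP (fun i => Z_of_int (z i ord0))).
  have /cV0Pn[i zi] : z != 0.
    apply: contraNneq t0 => z0; move: Vt; rewrite z0 scaler0 => /(congr1 (mulmx (\adj V))).
    rewrite mulmxA mul_adj_mx mul_scalar_mx mulmx0 => /eqP.
    by rewrite scalemx_eq0 (negPf Vnz).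
  by exists i => /(congr1 int_of_Z); rewrite Z_of_intK => /eqP; apply/negP.
exists r; split=> [|y yP]; first exact/RltP.
rewrite WP; have [|c' yE c'1] := rP (colR y).
  move=> i; have /RltP := yP i; rewrite RabsE RminusE -zc !mxE.
  by rewrite /zvec IZR_int_of_Z Z_of_intK.
have {yE} -> : colR y = \sum_j c' j ord0 *: toR (col j V).
  by rewrite yE; apply/colP => i; rewrite mxE summxE; apply: eq_bigr => j _; rewrite !mxE mulrC.
apply: hull_crosspolytope c'1.
- by exists (colR x); rewrite -WP; apply: Pe => i; rewrite /Rminus Rplus_opp_r Rabs_R0.
- move=> u uW; have := symP (vecR_of u); rewrite !WP vecR_ofK => -[/(_ uW)] + _.
  by congr hull; apply/colP => i; rewrite !mxE.
- by move=> j; rewrite -[toR _]vecR_ofK -WP.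
Qed.

(** Full dimension rules out the hyperplane case. The coordinates [c] survive the change of basis,
    since [w = V c] gives [U w = (U V) c]. *)
Lemma good_polytope_hermite d (P : vecR d -> Prop) : good_polytope P ->
  exists (W : seq 'cV[int]_d) (U H : 'M[int]_d),
    [/\ forall x, P x <-> hull [seq toR w | w <- W] (colR x), U \in unitmx,
      H \in all_hermite_forms d d`!, (0 < absz (\det H) <= d`!)%N &
      forall w, w \in W -> exists2 c : 'cV[R]_d,
        toR (U *m w) = toR H *m c & forall i, `|c i ord0| <= 1].
Proof.
move=> gP; have [/lattice_polytopeP[W WP] [fullP _]] := gP.
have [[u u0 uW]|/(maximal_determinant R)[V [Vnz VW Vmax]]] := hyperplane_or_basis R W.
  case/eqP: u0; apply: (full_dim_not_hyperplane fullP) => x.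
  rewrite WP => -[w [_ _ ->]]; rewrite mulmx_sumr; apply: big1 => k _.
  by rewrite -scalemxAr (nth_map 0) ?uW ?scaler0 ?mem_nth // -(size_map toR W).
have Vd : (absz (\det V) <= d`!)%N.
  apply: good_polytope_det gP Vnz _ => j.
  by rewrite WP vecR_ofK; apply: mem_hull; rewrite map_f.
have [U Uu UV] := hermite_form_exists Vnz.
exists W, U, (U *m V); split=> //.
- apply/flattenP; exists (hermite_forms d (absz (\det V))) => //.
  by apply: map_f; rewrite mem_iota absz_gt0 Vnz.
- by rewrite det_mulmx abszM_unit -?unitmxE // absz_gt0 Vnz.
move=> w /Vmax[c wc c1]; exists c => //.
by rewrite !map_mxM wc mulmxA.
Qed.

(** * Encoding and counting orbits *)

(** A relation, as neither [W] nor [U] is canonical. All bit vectors have the common length [N];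
    bits past the end of [f code.1] merely test the default point [0]. *)
Definition orbit_code d (f : 'M[int]_d -> seq 'cV[int]_d) (N : nat) (P : vecR d -> Prop)
    (code : 'M[int]_d * {ffun 'I_N -> bool}) :=
  exists (W : seq 'cV[int]_d) (U : 'M[int]_d),
    [/\ forall x, P x <-> hull [seq toR w | w <- W] (colR x), U \in unitmx,
      {subset [seq U *m w | w <- W] <= f code.1}, (size (f code.1) <= N)%N &
      code.2 = [ffun i : 'I_N => (f code.1)`_i \in [seq U *m w | w <- W]]].

(** The bit at the index of [z] in [f H] decides whether [z] is in [U W], so equal codes give
    [U W = U' W'] as sets, and [U'^-1 U] carries [P] to [Q]. *)
Lemma orbit_code_GL_equiv d f N (P Q : vecR d -> Prop) code :
  @orbit_code d f N P code -> orbit_code f Q code -> GL_equiv P Q.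
Proof.
case: code => H b [W [U [PW Uu WH sH /= bW]]] [W' [U' [QW' U'u W'H _ /= bW']]].
have UW : [seq U *m w | w <- W] =i [seq U' *m w | w <- W'].
  move=> z; have [zH|zH] := boolP (z \in f H); last first.
    by rewrite (contraNF (@WH z) zH) (contraNF (@W'H z) zH).
  have kN : (index z (f H) < N)%N by apply: leq_trans sH; rewrite index_mem.
  have /ffunP/(_ (Ordinal kN)) := etrans (esym bW) bW'.
  by rewrite !ffunE /= nth_index.
apply: (GL_equiv_hull PW QW' (A := invmx U' *m U)).
  by rewrite unitmx_mul unitmx_inv U'u.
move=> w; apply/idP/mapP => [wW'|[v vW ->]].
  have : U' *m w \in [seq U *m w | w <- W] by rewrite UW map_f.
  by case/mapP => v vW E; exists v; rewrite // -mulmxA -E mulKmx.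
have : U *m v \in [seq U' *m w | w <- W'] by rewrite -UW map_f.
by case/mapP => w' w'W' E; rewrite -mulmxA E mulKmx.
Qed.

(* "At most N orbits": any family of such polytopes that are pairwise in
   distinct GL_d(Z)-orbits has at most N members. *)
Theorem theorem11p1 (d : nat) (hd : (1 <= d)%N)
  (Ps : seq (vecR d -> Prop))
  (Hgood : forall k, (k < size Ps)%N -> good_polytope (nth (fun _ => False) Ps k))
  (Hdistinct : forall k l, (k < size Ps)%N -> (l < size Ps)%N -> k <> l ->
      ~ GL_equiv (nth (fun _ => False) Ps k) (nth (fun _ => False) Ps l)) :
  (size Ps <= (d`!) ^ (d + 1) * 2 ^ (3 ^ d * d`!))%N.
Proof.
set N := (3 ^ d * d`!)%N.
(* One list is fixed for each [H], so that polytopes sharing [H] are coded against the same list;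
   singular [H] get the empty one. *)
have /choice[f fP] (H : 'M[int]_d) : exists s : seq 'cV[int]_d, \det H != 0 ->
    (size s <= 3 ^ d * absz (\det H))%N /\ forall (z : 'cV[int]_d) (c : 'cV[R]_d),
      toR z = toR H *m c -> (forall i, `|c i ord0| <= 1) -> z \in s.
  have [->|/(lattice_points_in_parallelepiped R)[s sP]] := eqVneq (\det H) 0.
    by exists [::].
  by exists s.
pose codes := [seq (H, b) | H <- all_hermite_forms d d`!, b <- enum {ffun 'I_N -> bool}].
have /choice[code codeP] k : exists c, (k < size Ps)%N ->
    orbit_code f (nth (fun _ => False) Ps k) c /\ c \in codes.
  have [kn|kn] := boolP (k < size Ps)%N; last by exists (0, [ffun=> false]).
  have [W [U [H [PW Uu Hin /andP[H0 Hd] Wc]]]] := good_polytope_hermite (Hgood k kn).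
  rewrite absz_gt0 in H0; have [sH cH] := fP H H0.
  exists (H, [ffun i : 'I_N => (f H)`_i \in [seq U *m w | w <- W]]) => _; split.
    exists W, U; split=> // [_ /mapP[w /Wc[c wc c1] ->]|/=]; first exact: cH c1.
    by apply: leq_trans sH _; rewrite leq_mul2l Hd orbT.
  by apply: allpairs_f; rewrite ?mem_enum.
apply: (@leq_trans (size codes)); last first.
  rewrite size_allpairs -cardE card_ffun card_bool card_ord leq_mul2r.
  by rewrite size_all_hermite_forms orbT.
rewrite -(size_iota 0 (size Ps)) -(size_map code); apply: uniq_leq_size.
  (* Distinct indices with the same code would give equivalent polytopes, against [Hdistinct]. *)
  rewrite map_inj_in_uniq ?iota_uniq // => k l; rewrite !mem_iota /= !add0n => kn ln E.
  have [// | /eqP kl] := eqVneq k l.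
  have [ck _] := codeP k kn; have [cl _] := codeP l ln; rewrite -E in cl.
  by case: (Hdistinct k l kn ln kl); apply: orbit_code_GL_equiv ck cl.
by move=> _ /mapP[k + ->]; rewrite mem_iota /= add0n => /codeP[].
Qed.
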